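(* Every ccc Hausdorff space $X$ is $\chi$-Lindelöf.
   Context: All spaces are assumed to be Hausdorff. A space is ccc (satisfies the countable chain condition) if every family of pairwise disjoint open sets is countable. The character $\chi(X)$ of a space $X$ is the smallest infinite cardinal $\kappa$ such that every point of $X$ has a local base of cardinality not exceeding $\kappa$. $[S]^{<\omega}$ denotes the collection of all finite subsets of $S$, and $\overline{B}$ denotes the closure of $B$ in $X$. ''Countable'' means of cardinality at most $\omega$. For a cardinal $\kappa$, a $\kappa$-net in $X$ is an indexed family $\xi=\{x_F:F\in[\kappa]^{<\omega}\}$ of points of $X$ (indexed by the finite subsets of $\kappa$; repetitions allowed). We write $\xi\subseteq A$ if $x_F\in A$ for all $F$. Let $A\subseteq X$ and let $\xi=\{x_F:F\in[\kappa]^{<\omega}\}\subseteq A$ be a $\kappa$-net. A point $x\in A$ is a $\theta$-cluster point of $\xi$ relative to $A$ if, for every open set $U$ of $X$ with $x\in U$ and every $\alpha<\kappa$, there exists $F\in[\kappa]^{<\omega}$ such that $\alpha\in F$ and $x_F\in\overline{U\cap A}$. If $A=X$, we say that $x$ is a $\theta$-cluster point of $\xi$ (in $X$). A set $A\subseteq X$ is $\chi$-net-closed if for every $\chi(X)$-net $\xi=\{x_F:F\in[\chi(X)]^{<\omega}\}\subseteq A$: if $\xi$ has a $\theta$-cluster point in $X$, then $\xi$ has a $\theta$-cluster point in $A$ relative to $A$. A space $X$ is $\chi$-Lindelöf if for every $\chi$-net-closed set $A\subseteq X$ and every collection $\mathcal{U}=\bigcup\{\mathcal{U}_\alpha:\alpha<\chi(X)\}$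 of open sets in $X$ which covers $A$ (presented as a union of subcollections $\mathcal{U}_\alpha$), there are countable subcollections $\mathcal{V}_\alpha\subseteq\mathcal{U}_\alpha$ for each $\alpha<\chi(X)$ such that $A\subseteq\bigcup\{\overline{\bigcup\mathcal{V}_\alpha}:\alpha<\chi(X)\}$. *)

(* Defs.v *)
From mathcomp Require Import all_boot finmap.
From mathcomp Require Import boolp classical_sets functions cardinality.
From mathcomp Require Import topology.

Set Implicit Arguments.
Unset Strict Implicit.
Unset Printing Implicit Defensive.

Local Open Scope classical_set_scope.
Local Open Scope card_scope.

Section least_cardinal.

Lemma least_card_ex (U : Type) (P : set (set U)) : P !=set0 ->
  exists2 A, P A & forall B, P B -> A #<= B.
Proof.
move=> [A0 PA0].
have [[A [PA An0]]|allne] := pselect (exists A, P A /\ ~ (A !=set0)).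
  exists A => // B _.
  have -> : A = set0 by rewrite -subset0 => x Ax; apply: An0; exists x.
  exact: card_ge0.
have ne A : P A -> A !=set0.
  by move=> PA; apply: contrapT => An0; apply: allne; exists A.
have [u0 _] := ne _ PA0.
pose good (S : set (set U -> U)) :=
  (forall f B, S f -> P B -> B (f B)) /\
  (forall f g B, S f -> S g -> P B -> f B = g B -> f = g).
have [F FP Ftot|S [[Sin Sinj] Smax]] := @Zorn_bigcup _ good.
  split=> [f B [X FX Xf] PB|f g B [X FX Xf] [Y FY Yg] PB fg].
    by have [Xin _] := FP X FX; exact: (Xin f B Xf PB).
  have [XY|YX] := Ftot X Y FX FY.
    by have [_ Yi] := FP Y FY; apply: (Yi f g B) => //; exact: XY.
  by have [_ Xi] := FP X FX; apply: (Xi f g B) => //; exact: YX.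
have [[A [PA Asurj]]|nsurj] :=
    pselect (exists A, P A /\ forall a, A a -> exists2 f, S f & f A = a).
  exists A => // B PB.
  have -> : A = (fun f => f A) @` S.
    rewrite eqEsubset; split=> [a /Asurj[f Sf <-]|_ [f Sf <-]].
      by exists f.
    exact: (Sin f A Sf PA).
  apply: (card_le_trans (card_image_le _ _)).
  have SB : (fun f => f B) @` S #= S.
    by apply: inj_card_eq => f g /set_mem Sf /set_mem Sg; exact: Sinj.
  rewrite -(card_le_eql SB).
  by apply: subset_card_le => _ [f Sf <-]; exact: (Sin f B Sf PB).
have /boolp.choice[h hP] B :
    exists u, P B -> B u /\ forall f, S f -> f B <> u.
  have [PB|nPB] := pselect (P B); last by exists u0.
  apply: contrapT => no; apply: nsurj; exists B; split=> // a Ba.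
  apply: contrapT => na; apply: no; exists a => _; split=> // f Sf fa.
  by apply: na; exists f.
have nSh : ~ S h by move=> Sh; have [_ /(_ _ Sh)] := hP _ PA0.
case: (Smax (S `|` [set h])).
  split; first by move=> f; left.
  by move=> /(_ h); apply/not_implyP; split=> //; right.
split=> [f B [Sf|->] PB|f g B [Sf|->] [Sg|->] PB //].
- exact: (Sin f B Sf PB).
- by have [] := hP _ PB.
- exact: Sinj.
- by have [_ /(_ _ Sf)] := hP _ PB.
- by have [_ /(_ _ Sg) gh] := hP _ PB => hg; case: gh.
Qed.

Lemma card_le_tot (U V : Type) (A : set U) (B : set V) : A #<= B \/ B #<= A.
Proof.
have iA : (@inl U V) @` A #= A by apply: inj_card_eq => x y _ _ [].
have iB : (@inr U V) @` B #= B by apply: inj_card_eq => x y _ _ [].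
have [|C [->|->] Cmin] :=
    @least_card_ex _ [set (@inl U V) @` A; (@inr U V) @` B].
- by exists ((@inl U V) @` A); left.
- left; rewrite -(card_le_eql iA) -(card_le_eqr iB).
  by apply: Cmin; right.
- right; rewrite -(card_le_eql iB) -(card_le_eqr iA).
  by apply: Cmin; left.
Qed.

End least_cardinal.

Definition local_base (X : topologicalType) (x : X) (B : set (set X)) :=
  (forall U, B U -> open U /\ U x) /\
  (forall V, open V -> V x -> exists2 U, B U & U `<=` V).

(* The cardinals that bound the character; a cardinal is given by a set [K],
   in any type, having that cardinality. *)
Definition char_bound (X : topologicalType) (T : Type) (K : set T) :=
  infinite_set K /\
  forall x : X, exists2 B : set (set X), local_base x B & B #<= K.

Definition is_character (X : topologicalType) (T : Type) (K : set T) :=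
  char_bound X K /\ forall (V : Type) (L : set V), char_bound X L -> K #<= L.

Lemma character_exists (X : topologicalType) :
  exists K : set (set X + nat), is_character X K.
Proof.
pose U := (set X + nat)%type.
have boundT : char_bound X [set: U].
  split.
    apply: (@sub_infinite_set _ (range (@inr (set X) nat))) => //.
    have rnat : range (@inr (set X) nat) #= [set: nat].
      by apply: inj_card_eq => x y _ _ [].
    by apply/infiniteP; rewrite (card_le_eqr rnat).
  move=> x; exists [set O | open O /\ O x].
    by split=> [//|V oV Vx]; exists V.
  have iO : (@inl (set X) nat) @` [set O | open O /\ O x] #=
      [set O | open O /\ O x].
    by apply: inj_card_eq => u v _ _ [].
  by rewrite -(card_le_eql iO); exact: subset_card_le.
have [|K bK Kmin] := @least_card_ex U [set K | char_bound X K].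
  by exists [set: U].
exists K; split=> // V L [Linf Lbase].
have [UL|LU] := card_le_tot [set: U] L.
  by apply: (card_le_trans _ UL); exact: subset_card_le.
have /card_leP[f] := LU.
have fL : range (fun y => val (f y)) #= L.
  apply: (card_eq_trans _ (card_setT L)).
  by apply: inj_card_eq => y z _ _ /val_inj; apply: inj; exact: mem_set.
rewrite -(card_le_eqr fL); apply: Kmin; split.
  by apply/infiniteP; rewrite (card_le_eqr fL); exact/infiniteP.
move=> x; have [B Bx BL] := Lbase x.
by exists B => //; rewrite (card_le_eqr fL).
Qed.

Definition chi_set (X : topologicalType) : set (set X + nat) :=
  sval (cid (character_exists X)).
Arguments chi_set X : clear implicits.

Lemma chi_setP (X : topologicalType) : is_character X (chi_set X).
Proof. exact: svalP (cid (character_exists X)). Qed.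

(* The cardinal chi(X), as a type whose elements play the role of the ordinals
   alpha < chi(X): their order is never used, only how many there are. *)
Definition chi (X : topologicalType) : choiceType := set_type (chi_set X).

Lemma chiP (X : topologicalType) : is_character X [set: chi X].
Proof.
have [[Kinf Kbase] Kmin] := chi_setP X.
have eqK : [set: chi X] #= chi_set X := card_setT _.
split; last by move=> V L bL; rewrite (card_le_eql eqK); exact: Kmin.
split; first by apply/infiniteP; rewrite (card_le_eqr eqK); exact/infiniteP.
move=> x; have [B Bx BK] := Kbase x.
by exists B => //; rewrite (card_le_eqr eqK).
Qed.

Definition ccc (X : topologicalType) :=
  forall F : set (set X), F `<=` open -> trivIset F id -> countable F.

Definition net (K : choiceType) (X : Type) := {fset K} -> X.

Definition theta_cluster (K : choiceType) (X : topologicalType) (A : set X)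
    (xi : net K X) (x : X) :=
  A x /\
  forall U : set X, open U -> U x -> forall alpha : K,
    exists F : {fset K}, alpha \in F /\ closure (U `&` A) (xi F).

Definition chi_net_closed (X : topologicalType) (A : set X) :=
  forall xi : net (chi X) X, range xi `<=` A ->
    (exists x, theta_cluster [set: X] xi x) ->
    exists x, theta_cluster A xi x.

Definition chi_Lindelof (X : topologicalType) :=
  forall A : set X, chi_net_closed A ->
  forall U : chi X -> set (set X),
    (forall alpha, U alpha `<=` open) ->
    A `<=` \bigcup_alpha \bigcup_(O in U alpha) O ->
    exists V : chi X -> set (set X),
      (forall alpha, V alpha `<=` U alpha /\ countable (V alpha)) /\
      A `<=` \bigcup_alpha closure (\bigcup_(O in V alpha) O).

(* Main.v *)
Require Import Defs.
From mathcomp Require Import all_boot boolp classical_sets topology.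
From mathcomp Require Import cardinality.

(** The countable chain condition already gives the weak Lindelof property for
every family of open sets: such a family has a countable subfamily whose union
is dense in the union of the whole family ([ccc_countable_dense_subfamily]).
Choosing one such subfamily inside each of the given families, every point of
[A] lies in a member of some family, hence in the closure of the union of the
subfamily chosen for it. *)

Local Open Scope classical_set_scope.

(** Take a maximal disjoint family of open sets that each fit inside a member of
[U]. It is countable by ccc, and so is the family [V] obtained by picking for
each of them one member of [U] around it. A point of a member [O] of [U]
outside the closure of the union of [V] would have an open neighbourhood inside
[O] disjoint from that union, which could be added to the maximal family. *)
Lemma ccc_countable_dense_subfamily (X : topologicalType) (U : set (set X)) :
  ccc X -> U `<=` open ->
  exists V : set (set X), [/\ V `<=` U, countable V &
    \bigcup_(O in U) O `<=` closure (\bigcup_(O in V) O)].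
Proof.
move=> cccX Uopen.
pose refines (W : set X) := open W /\ exists2 O, U O & W `<=` O.
have [F [Fref Ftriv Fmax]] := ex_maximal_disjoint_subcollection id refines.
have /choice[f fP] W : exists O, F W -> U O /\ W `<=` O.
  have [/Fref[_ [O UO WO]]|nFW] := pselect (F W); first by exists O.
  by exists set0.
have Fle W : F W -> W `<=` \bigcup_(O in f @` F) O.
  by move=> FW y Wy; exists (f W); [exists W|have [_] := fP _ FW; apply].
exists (f @` F); split=> [_ [W /fP[UfW _] <-] //||x [O UO Ox]].
  apply: (card_le_trans (card_image_le _ _)).
  by apply: cccX => // W /Fref[].
move=> N; rewrite nbhsE => -[N' [oN' N'x] N'N].
apply: contrapT => Ndisj.
pose W := N' `&` O.
have Wx : W x by [].
have Wdisj y : W y -> ~ (\bigcup_(O in f @` F) O) y.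
  by move=> [N'y _] Vy; apply: Ndisj; exists y; split=> //; exact: N'N.
case: (Fmax (F `|` [set W])).
- split; first by move=> W' FW'; left.
  by move=> /(_ W (or_intror erefl)) /Fle /(_ x Wx); exact: Wdisj.
- move=> W' [/Fref //|->].
  by split; [apply: openI => //; exact: Uopen|exists O => // y []].
move=> W1 W2 [F1|->] [F2|->] // [y [y1 y2]].
- by apply: Ftriv => //; exists y.
- by case: (Wdisj y y2); exact: Fle y1.
- by case: (Wdisj y y1); exact: Fle y2.
Qed.

Theorem proposition10 (X : topologicalType) (X_hausdorff : hausdorff_space X)
  (X_ccc : ccc X) : chi_Lindelof X.
Proof.
move=> A _ U Uopen AU.
have /choice[V VP] alpha :=
  @ccc_countable_dense_subfamily X (U alpha) X_ccc (Uopen alpha).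
exists V; split=> [alpha|x /AU[alpha _ Ux]]; first by have [] := VP alpha.
by exists alpha => //; have [_ _] := VP alpha; apply.
Qed.
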